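(* For every $z\in\mathbb C$ that is not an eigenvalue of $A_j^{U,Z}$, the residual $\mathrm{Res}_{B,j}(z)=B-(zI-A)X_{B,j}(z)$ of the Petrov-Galerkin approximation $X_{B,j}(z)=\mathbf U_j(zI-A_j^{U,Z})^{-1}E_1R_B$ satisfies $$\mathrm{Res}_{B,j}(z)=\Pi_{U,Z}\,U_{j+1}\,\Gamma_{j+1}^U\,E_j^*K_{U,j}^{-1}(zI-A_j^{U,Z})^{-1}E_1R_B,$$ where $\Gamma_{j+1}^U$ denotes the $(j+1,j)$ block of $\underline H_{U,j}$.
   Context: Let $A\in\mathbb C^{n\times n}$, $B\in\mathbb C^{n\times s}$ with $s>1$, $j\ge 1$, and shifts $\Sigma=\{\sigma_1,\dots,\sigma_{j-1}\}\subset\mathbb C\cup\{\infty\}$, the finite ones not eigenvalues of $A$. Put $\varphi(z)=\prod_{\sigma_i\neq\infty}(z-\sigma_i)$ and $E_i=e_i\otimes I_s$ (size clear from the context). For an $s\times s$ matrix polynomial $P(\lambda)=\sum_i\lambda^iP_i$ and a block vector $W$ with $s$ columns, $P(N)\circ W:=\sum_iN^iWP_i$. Block rational Krylov spaces: $\mathcal{RK}^\square_j(A,B,\Sigma)=\{\varphi(A)^{-1}(P(A)\circ B):\deg P<j\}$ and $\mathcal{RK}^\square_{j+1}(A,B,\Sigma)=\{\varphi(A)^{-1}(P(A)\circ B):\deg P\le j\}$ (last pole at infinity). Standing assumptions. The block rational Arnoldi procedure for $\mathcal{RK}^\square_{j+1}(A,B,\Sigma)$ runs without breakdown or deflation (every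 generated block has full rank $s$), with the last pole at infinity. It gives a matrix with orthonormal columns $\mathbf U_{j+1}=[U_1,\dots,U_{j+1}]$, $U_i\in\mathbb C^{n\times s}$, such that $\mathcal{RK}^\square_m(A,B,\Sigma)=\{\sum_{i\le m}U_iC_i: C_i\in\mathbb C^{s\times s}\}$ for $m=j,j+1$, $B=U_1R_B$ with $R_B\in\mathbb C^{s\times s}$ invertible, and block upper Hessenberg $(j+1)s\times js$ matrices $\underline H_{U,j},\underline K_{U,j}$ (with $s\times s$ blocks) with $A\mathbf U_{j+1}\underline K_{U,j}=\mathbf U_{j+1}\underline H_{U,j}$ and last block row of $\underline K_{U,j}$ equal to zero. $H_{U,j},K_{U,j}$ are their top $js\times js$ parts ($K_{U,j}$ is invertible). Let $\mathbf U_j=[U_1,\dots,U_j]$, and let $\mathbf Z_j\in\mathbb C^{n\times js}$ have orthonormal columns with $\mathbf Z_j^*\mathbf U_j$ invertible. Put $A_j^{U,Z}=(\mathbf Z_j^*\mathbf U_j)^{-1}\mathbf Z_j^*A\mathbf U_j$ and $\Pi_{U,Z}=I-\mathbf U_j(\mathbf Z_j^*\mathbf U_j)^{-1}\mathbf Z_j^*$. The finite shifts $\sigma_i$ are not eigenvalues of $A_j^{U,Z}$. *)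

(* Defs.v *)
From mathcomp Require Import all_boot all_order all_algebra.
From mathcomp Require Import boolp classical_sets reals complex.

Set Implicit Arguments.
Unset Strict Implicit.
Unset Printing Implicit Defensive.

Import Order.TTheory GRing.Theory Num.Theory.
Local Open Scope classical_set_scope.
Local Open Scope sesquilinear_scope.
Local Open Scope ring_scope.

(* The dimension m * s in the form \sum_(i < m) s, so that the block operations
   \mxrow, \mxcol, \mxblock, submxblock of matrix.v apply directly. *)
Notation bdim m s := (\sum_(i < m) s)%N (only parsing).

Definition first_ord m (hm : (0 < m)%N) : 'I_m := Ordinal hm.
Definition last_ord m (hm : (0 < m)%N) : 'I_m := rev_ord (Ordinal hm).

Section BlockKrylov.

Variable C : numClosedFieldType.

(* e_i (x) I_s, with m blocks. *)
Definition blockE m s (i : 'I_m) : 'M[C]_(bdim m s, s) :=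
  \mxcol_(k < m) ((k == i)%:R%:M : 'M[C]_s).

(* p(N), for N of any size ([horner_mx] requires a size of the form n.+1). *)
Definition mxeval n (p : {poly C}) (N : 'M[C]_n) : 'M[C]_n :=
  \sum_(i < size p) p`_i *: (N ^+ i).

(* An s x s matrix polynomial is a matrix P with entries in {poly C}; its i-th
   coefficient is [map_mx (coefp i) P]. As with [size], mpsize P = deg P + 1,
   and mpsize 0 = 0, so that deg P < d is mpsize P <= d. *)
Definition mpsize s (P : 'M[{poly C}]_s) : nat :=
  (\max_(a < s) \max_(b < s) size (P a b))%N.

(* P(N) o W *)
Definition mpcirc n s (P : 'M[{poly C}]_s) (N : 'M[C]_n) (W : 'M[C]_(n, s)) :
    'M[C]_(n, s) :=
  \sum_(i < mpsize P) (N ^+ i) *m W *m map_mx (coefp i) P.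

(* Shifts in the Riemann sphere: [None] is the shift at infinity. *)
Definition shift_poly m (Sigma : m.-tuple (option C)) : {poly C} :=
  \prod_(sigma <- Sigma) (if sigma is Some c then 'X - c%:P else 1).

Definition shifts_avoid m n (Sigma : m.-tuple (option C)) (N : 'M[C]_n) :=
  forall c : C, Some c \in Sigma -> ~~ eigenvalue N c.

(* { phi(A)^-1 (P(A) o B) : deg P < d }. With j - 1 shifts in Sigma, d = j is
   the space RK_j, and d = j + 1 is RK_{j+1} with last pole at infinity. *)
Definition block_krylov m n s (A : 'M[C]_n) (B : 'M[C]_(n, s))
    (Sigma : m.-tuple (option C)) (d : nat) : set 'M[C]_(n, s) :=
  [set X | exists2 P : 'M[{poly C}]_s, (mpsize P <= d)%N &
     X = invmx (mxeval (shift_poly Sigma) A) *m mpcirc P A B].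

Definition block_span n s m (U : 'I_m -> 'M[C]_(n, s)) : set 'M[C]_(n, s) :=
  [set X | exists c : 'I_m -> 'M[C]_s, X = \sum_(i < m) U i *m c i].

Definition orthonormal_cols n p (V : 'M[C]_(n, p)) := V ^t* *m V = 1%:M.

Definition block_row n s m (U : 'I_m -> 'M[C]_(n, s)) : 'M[C]_(n, bdim m s) :=
  \mxrow_(i < m) U i.

Definition drop_last T m (U : 'I_m.+1 -> T) : 'I_m -> T :=
  fun i => U (widen_ord (leqnSn m) i).

Definition block_hessenberg s m (H : 'M[C]_(bdim m.+1 s, bdim m s)) :=
  forall (a : 'I_m.+1) (b : 'I_m), (b.+1 < a)%N -> submxblock H a b = 0.

Definition top_part s m (H : 'M[C]_(bdim m.+1 s, bdim m s)) :
    'M[C]_(bdim m s, bdim m s) :=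
  \mxblock_(a < m, b < m) submxblock H (widen_ord (leqnSn m) a) b.

(* The output of j steps of the block rational Arnoldi procedure run without
   breakdown or deflation, with the last pole at infinity. *)
Record block_rational_arnoldi n s j (A : 'M[C]_n) (B : 'M[C]_(n, s))
    (Sigma : j.-1.-tuple (option C)) (U : 'I_j.+1 -> 'M[C]_(n, s))
    (RB : 'M[C]_s) (H K : 'M[C]_(bdim j.+1 s, bdim j s)) : Prop :=
  BlockRationalArnoldi {
    bra_orthonormal : orthonormal_cols (block_row U);
    bra_krylov : block_krylov A B Sigma j = block_span (drop_last U);
    bra_krylovS : block_krylov A B Sigma j.+1 = block_span U;
    bra_start : B = U ord0 *m RB;
    bra_start_unit : RB \in unitmx;
    bra_hessH : block_hessenberg H;
    bra_hessK : block_hessenberg K;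
    bra_decomposition : A *m block_row U *m K = block_row U *m H;
    bra_last_row : forall b : 'I_j, submxblock K ord_max b = 0;
    bra_topK_unit : top_part K \in unitmx
  }.

(* (Z^* V)^-1 Z^* A V *)
Definition oblique_compression n p (A : 'M[C]_n) (V Z : 'M[C]_(n, p)) : 'M[C]_p :=
  invmx (Z ^t* *m V) *m Z ^t* *m A *m V.

(* I - V (Z^* V)^-1 Z^* *)
Definition oblique_coprojector n p (V Z : 'M[C]_(n, p)) : 'M[C]_n :=
  1%:M - V *m invmx (Z ^t* *m V) *m Z ^t*.

(* X_{B,j}(z) *)
Definition petrov_galerkin n s j (hj : (0 < j)%N) (A : 'M[C]_n)
    (V Z : 'M[C]_(n, bdim j s)) (RB : 'M[C]_s) (z : C) : 'M[C]_(n, s) :=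
  V *m invmx (z%:M - oblique_compression A V Z) *m
    blockE s (first_ord hj) *m RB.

Definition residual n s (A : 'M[C]_n) (B : 'M[C]_(n, s)) (X : C -> 'M[C]_(n, s))
    (z : C) : 'M[C]_(n, s) :=
  B - (z%:M - A) *m X z.

End BlockKrylov.

(* Main.v *)
Require Import Defs.
From mathcomp Require Import all_boot all_order all_algebra.
From mathcomp Require Import boolp classical_sets reals complex.
From mathcomp Require Import zify.

Set Implicit Arguments.
Unset Strict Implicit.
Unset Printing Implicit Defensive.

Import Order.TTheory GRing.Theory Num.Theory.
Local Open Scope sesquilinear_scope.
Local Open Scope ring_scope.

(** Write V = [U_1 .. U_j] and M = A_j^{U,Z}.  The residual is governed by one
    object, Pi A V, where Pi is the oblique coprojector along V.

    On the one hand, A V = V M + Pi A V merely splits A V along the projector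
    I - Pi onto the columns of V.  Since B = V E_1 R_B lies in that column
    space, the Galerkin solution cancels the whole component of the residual
    in it, and what remains is Pi A V (zI - M)^-1 E_1 R_B
    ([residual_petrov_galerkin]).

    On the other hand, as the last block row of K vanishes and the last block
    row of H has only its final block, the Arnoldi decomposition reads
    A V K_j = V H_j + U_{j+1} Gamma E_j^* ([bra_short_decomposition]).
    The coprojector kills V, so Pi A V = Pi U_{j+1} Gamma E_j^* K_j^-1. *)

Lemma not_eigenvalue_unitmx (F : fieldType) p (M : 'M[F]_p) z :
  ~~ eigenvalue M z -> z%:M - M \in unitmx.
Proof.
rewrite /eigenvalue /eigenspace negbK kermx_eq0 row_free_unit => hM.
by rewrite -opprB -scaleN1r unitmxZ ?unitrN1.
Qed.

Lemma oblique_coprojector_mul (C : numClosedFieldType) n p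
    (V Z : 'M[C]_(n, p)) :
  Z ^t* *m V \in unitmx -> oblique_coprojector V Z *m V = 0.
Proof.
by move=> hZV; rewrite mulmxBl mul1mx -!mulmxA mulVmx // mulmx1 subrr.
Qed.

Lemma oblique_splitting (C : numClosedFieldType) n p (A : 'M[C]_n)
    (V Z : 'M[C]_(n, p)) :
  A *m V = V *m oblique_compression A V Z + oblique_coprojector V Z *m (A *m V).
Proof.
by rewrite /oblique_compression mulmxBl mul1mx !mulmxA addrC subrK.
Qed.

Lemma block_row_mul_blockE (C : numClosedFieldType) n s m
    (U : 'I_m -> 'M[C]_(n, s)) i :
  block_row U *m blockE C s i = U i.
Proof.
rewrite mul_mxrow_mxcol (bigD1 i) //= eqxx mulmx1 big1 ?addr0 // => k /negPf ->.
by rewrite raddf0 mulmx0.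
Qed.

Lemma block_row_mul_recr (C : numClosedFieldType) n s m
    (U : 'I_m.+1 -> 'M[C]_(n, s)) (M : 'M[C]_(bdim m.+1 s, bdim m s)) :
  block_row U *m M =
    block_row (drop_last U) *m top_part M + U ord_max *m submxcol M ord_max.
Proof.
rewrite -{1}[M]submxcolK mul_mxrow_mxcol big_ord_recr /=; congr (_ + _).
rewrite /top_part mxblockEv mul_mxrow_mxcol; apply: eq_bigr => i _.
congr (_ *m _); rewrite -[LHS]submxrowK; apply: eq_mxrow => k.
by rewrite submxblockEv.
Qed.

Lemma block_hessenberg_last_row (C : numClosedFieldType) s j (hj : (0 < j)%N)
    (H : 'M[C]_(bdim j.+1 s, bdim j s)) :
  block_hessenberg H ->
  submxcol H ord_max =
    submxblock H ord_max (last_ord hj) *m (blockE C s (last_ord hj)) ^t*.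
Proof.
move=> hH; rewrite -[LHS]submxrowK /blockE tr_mxcol -[map_mx _ _]submxrowK.
rewrite mul_mxrow; apply: eq_mxrow => k; rewrite -submxblockEv.
have -> : submxrow (map_mx Num.conj
    (\mxrow_(i < j) ((i == last_ord hj)%:R%:M : 'M[C]_s)^T)) k
    = ((k == last_ord hj)%:R%:M : 'M[C]_s).
  rewrite /submxrow -map_mxsub -/(submxrow _ k) mxrowK tr_scalar_mx.
  by rewrite map_scalar_mx rmorph_nat.
have [->|hk] := eqVneq; first by rewrite mulmx1.
rewrite raddf0 mulmx0; apply: hH.
(* [last_ord hj] has value j - 1, so another column index k has k + 1 < j. *)
by move: hk; rewrite -val_eqE /=; have := ltn_ord k; lia.
Qed.

(** The vanishing last block row of K removes U_{j+1} from the left-hand side,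
    and invertibility of the top part of K lets A V itself be isolated. *)
Lemma bra_short_decomposition (C : numClosedFieldType) n s j (hj : (0 < j)%N)
    (A : 'M[C]_n) (B : 'M[C]_(n, s)) (Sigma : j.-1.-tuple (option C))
    (U : 'I_j.+1 -> 'M[C]_(n, s)) (RB : 'M[C]_s)
    (H K : 'M[C]_(bdim j.+1 s, bdim j s)) :
  block_rational_arnoldi A B Sigma U RB H K ->
  A *m block_row (drop_last U) =
    block_row (drop_last U) *m (top_part H *m invmx (top_part K))
    + U ord_max *m submxblock H ord_max (last_ord hj)
        *m (blockE C s (last_ord hj)) ^t* *m invmx (top_part K).
Proof.
case=> _ _ _ _ _ hH _ hAK hKlast hKunit.
have K0 : submxcol K ord_max = 0.
  rewrite -[LHS]submxrowK -[RHS]submxrowK; apply: eq_mxrow => k.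
  by rewrite -submxblockEv hKlast submxrow0.
move: hAK; rewrite -mulmxA !block_row_mul_recr K0 mulmx0 addr0.
rewrite (block_hessenberg_last_row hj hH) => hAK.
by rewrite -[LHS](mulmxK hKunit) -[A *m _ *m _]mulmxA hAK mulmxDl !mulmxA.
Qed.

(** With w := (zI - M)^-1 b, splitting A V turns (zI - A) V w into
    V (zI - M) w - Pi A V w = V b - Pi A V w. *)
Lemma residual_petrov_galerkin (C : numClosedFieldType) n s p (A : 'M[C]_n)
    (V Z : 'M[C]_(n, p)) (b : 'M[C]_(p, s)) (X : C -> 'M[C]_(n, s)) z :
  let M := oblique_compression A V Z in
  z%:M - M \in unitmx -> X z = V *m invmx (z%:M - M) *m b ->
  residual A (V *m b) X z =
    oblique_coprojector V Z *m (A *m V) *m invmx (z%:M - M) *m b.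
Proof.
move=> M hz hX; rewrite /residual hX -!(mulmxA _ (invmx _)).
set w := invmx _ *m b; set PAV := _ *m (A *m V).
have hAV : A *m V = V *m M + PAV := oblique_splitting A V Z.
have -> : b = (z%:M - M) *m w by rewrite mulmxA mulmxV // mul1mx.
clearbody w PAV M; rewrite !mulmxBl mulmxBr !mul_scalar_mx -scalemxAr !mulmxA hAV mulmxDl.
by rewrite opprB addrC addrA subrK addrAC subrr add0r.
Qed.

Theorem theorem2p18 (R : realType) (n s j : nat) (hs : (1 < s)%N) (hj : (0 < j)%N)
    (A : 'M[R[i]]_n) (B : 'M[R[i]]_(n, s)) (Sigma : j.-1.-tuple (option R[i]))
    (hSigma : shifts_avoid Sigma A)
    (U : 'I_j.+1 -> 'M[R[i]]_(n, s)) (RB : 'M[R[i]]_s)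
    (H K : 'M[R[i]]_(bdim j.+1 s, bdim j s))
    (hRA : block_rational_arnoldi A B Sigma U RB H K)
    (Z : 'M[R[i]]_(n, bdim j s)) (hZ : orthonormal_cols Z)
    (hZU : Z ^t* *m block_row (drop_last U) \in unitmx)
    (hSigmaj : shifts_avoid Sigma
                 (oblique_compression A (block_row (drop_last U)) Z)) :
  let Uj := block_row (drop_last U) in
  let Aj := oblique_compression A Uj Z in
  let Gamma := submxblock H ord_max (last_ord hj) in
  forall z : R[i], ~~ eigenvalue Aj z ->
    residual A B (petrov_galerkin hj A Uj Z RB) z =
      oblique_coprojector Uj Z *m U ord_max *m Gamma
        *m (blockE R[i] s (last_ord hj)) ^t* *m invmx (top_part K)
        *m invmx (z%:M - Aj) *m blockE R[i] s (first_ord hj) *m RB.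
Proof.
move=> Uj Aj Gamma z hz.
have hB : B = Uj *m (blockE R[i] s (first_ord hj) *m RB).
  rewrite mulmxA block_row_mul_blockE (bra_start hRA).
  by congr (U _ *m _); apply: val_inj.
rewrite [in LHS]hB (@residual_petrov_galerkin _ _ _ _ _ _ Z); first last.
- by rewrite /petrov_galerkin !mulmxA.
- exact: not_eigenvalue_unitmx.
rewrite (bra_short_decomposition hj hRA) mulmxDr [in X in X + _]mulmxA.
by rewrite oblique_coprojector_mul // mul0mx add0r !mulmxA.
Qed.
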